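(* Let $P$ be an ideal projector of type partial derivative on $\mathbb{R}[\bm{x}]=\mathbb{R}[x_1,\dots,x_d]$ with $$\mathrm{ran}P'=\mathrm{Span}_{\mathbb{R}}\{\delta_{\bm{\xi}^{(k)}}\circ \mathrm{D}^{\bm{\alpha}}:\ \bm{\alpha}\in\mathfrak{\Delta}^{(k)},\ 1\le k\le\mu\},$$ where $\bm{\xi}^{(1)},\dots,\bm{\xi}^{(\mu)}\in\mathbb{R}^d$ are distinct points and $\mathfrak{\Delta}^{(1)},\dots,\mathfrak{\Delta}^{(\mu)}\subset\mathbb{N}_0^d$ are their associated lower sets. Let $(P_h,\ 0<|h|<\eta)$ be a sequence of $h$-perturbed Lagrange projectors of $P$, where $\eta$ is the number (or $\infty$) obtained from these points and lower sets by the algorithm described in the context. If the range of $P_h$ is $\mathrm{ran}_{\prec_{lex}}P_h$, i.e. is spanned by the Gröbner éscalier $\mathcal{N}_{\prec_{lex}}(\ker P_h)$, then the sequence $(P_h,\ 0<|h|<\eta)$ converges pointwise to the ideal projector $P$, as $h$ tends to zero.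
   Context: $\mathbb{N}_0$ is the set of nonnegative integers. $\delta_{\bm{\xi}}:f\mapsto f(\bm{\xi})$ is evaluation at $\bm{\xi}\in\mathbb{R}^d$, and $\mathrm{D}^{\bm{\alpha}}=\partial^{\alpha_1+\cdots+\alpha_d}/\partial x_1^{\alpha_1}\cdots\partial x_d^{\alpha_d}$ for $\bm{\alpha}\in\mathbb{N}_0^d$, with $\mathrm{D}^{\bm{0}}$ the identity. A finite nonempty set $\mathfrak{\Delta}\subset\mathbb{N}_0^d$ is lower if $\bm{\alpha}\in\mathfrak{\Delta}$ and $\bm{0}\le\bm{\beta}\le\bm{\alpha}$ (componentwise) imply $\bm{\beta}\in\mathfrak{\Delta}$. An ideal projector on $\mathbb{R}[\bm{x}]$ is a linear idempotent map whose kernel is an ideal; all projectors here have finite-dimensional range. $\mathrm{ran}P'=\{\lambda\in\mathbb{R}'[\bm{x}]:\ \ker P\subset\ker\lambda\}$, where $\mathbb{R}'[\bm{x}]$ is the algebraic dual of $\mathbb{R}[\bm{x}]$. A Lagrange projector is an ideal projector whose kernel is the vanishing ideal of a finite nonempty subset of $\mathbb{R}^d$. An ideal projector is of type partial derivative if $\mathrm{ran}P'$ has the form displayed in the claim for some distinct points $\bm{\xi}^{(k)}$ and lower sets $\mathfrak{\Delta}^{(k)}$. Put $$\eta_0:=\min\left\{\frac{\|\bm{\xi}^{(k)}-\bm{\xi}^{(l)}\|_2}{\|\bm{\alpha}-\bm{\alpha}'\|_2}:\ \bm{\alpha}\in\mathfrak{\Delta}^{(k)},\ \bm{\alpha}'\in\mathfrak{\Delta}^{(l)},\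 \bm{\alpha}\ne\bm{\alpha}',\ 1\le k<l\le\mu\right\}.$$ For a fixed $h\in\mathbb{R}$ with $0<|h|<\eta_0$, $P_h$ is called an $h$-perturbed Lagrange projector of $P$ if it is the Lagrange projector on $\mathbb{R}[\bm{x}]$ with $\mathrm{ran}P_h'=\mathrm{Span}_{\mathbb{R}}\{\delta_{\bm{\xi}^{(k)}+h\bm{\alpha}}:\bm{\alpha}\in\mathfrak{\Delta}^{(k)},\ 1\le k\le\mu\}$. $\prec_{lex}$ is the lexicographic order on monomials with $x_1\succ x_2\succ\cdots\succ x_d$. For an ideal $I$, the Gröbner éscalier is $\mathcal{N}_{\prec_{lex}}(I)=\{\bm{x}^{\bm{\alpha}}:\ \mathrm{LM}_{\prec_{lex}}(f)\nmid\bm{x}^{\bm{\alpha}}\text{ for all nonzero } f\in I\}$, where $\mathrm{LM}_{\prec_{lex}}$ denotes the leading monomial. The algebraic multiset is $$\Omega=\{((\xi^{(k)}_1,\alpha_1),\dots,(\xi^{(k)}_d,\alpha_d)):\ \bm{\alpha}\in\mathfrak{\Delta}^{(k)},\ 1\le k\le\mu\}\subset(\mathbb{R}\times\mathbb{N}_0)^d.$$ Its rooted tree $T(\Omega)$ has $d$ levels below the root: the root is level $0$ and has no label; every element of $\Omega$ gives a path from the root to a leaf whose node at level $k$ is labeled by the element's $(d-k+1)$-th coordinate (level 1 carries the $d$-th coordinates, level 2 the $(d-1)$-th coordinates, and so on); two paths coincide up to level $k$ exactly when the corresponding elements agree in their last $k$ coordinates. Each node label is thus a pair $(\xi,\alpha)\in\mathbb{R}\times\mathbb{N}_0$.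 Algorithm for $\eta$. For a set $\mathcal{L}\subset\mathbb{R}\times\mathbb{N}_0$ write $$m(\mathcal{L})=\min\left\{\frac{|\xi-\xi'|}{|\alpha-\alpha'|}:\ (\xi,\alpha),(\xi',\alpha')\in\mathcal{L},\ \xi\ne\xi',\ \alpha\ne\alpha'\right\},$$ with $m(\mathcal{L})=\infty$ if there is no such pair. Let $\mathcal{L}_1$ be the set of labels of the level-1 nodes. If $\#\mathcal{L}_1=1$, or all points of $\mathcal{L}_1$ have the same first coordinate or all have the same second coordinate, set $\eta=\infty$; otherwise set $\eta=m(\mathcal{L}_1)$. Then for $k=2,\dots,d$ successively, let $\mathcal{L}_k^{(1)},\dots,\mathcal{L}_k^{(\nu)}$ be the sets of labels of the level-$k$ nodes grouped by common parent; for each $l$ with $\#\mathcal{L}_k^{(l)}\ge2$, compute $\eta'=m(\mathcal{L}_k^{(l)})$ and replace $\eta$ by $\eta'$ if $\eta'<\eta$. The output is the final $\eta$. Pointwise convergence means that, for every $q\in\mathbb{R}[\bm{x}]$, $P_hq\to Pq$ coefficientwise as $h\to0$.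
   Formalization: The range of P is additionally assumed to be spanned by the lex Gröbner éscalier of ker P; without this the claim fails, e.g. d=1, one point 0, Δ={0}, Pf=f(0)(1+x), where P_h f=f(0) does not tend to P. *)

(* Defs.v *)
From HB Require Import structures.
From mathcomp Require Import all_boot all_order all_algebra.
From mathcomp Require Import finmap.
From mathcomp Require Import all_classical all_reals topology normedtype.
(* the notations of mpoly clash with those of the analysis library *)
From mathcomp Require Export -(notations) mpoly.
Export numFieldNormedType.Exports.

Set Implicit Arguments.
Unset Strict Implicit.
Unset Printing Implicit Defensive.

Import Order.TTheory GRing.Theory Num.Theory.

Local Open Scope ring_scope.
Local Open Scope classical_set_scope.

Notation "{ 'mpoly' R [ n ] }" := (mpoly n R)
  (format "{ 'mpoly'  R [ n ] }") : type_scope.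

Section Functionals.
Context {R : realType}.

Definition kernel (U : Type) (V : zmodType) (f : U -> V) : set U :=
  [set x | f x = 0].

Definition lspan (V : lmodType R) (S : set V) : set V :=
  [set v | exists (n : nat) (c : 'I_n -> R) (b : 'I_n -> V),
     (forall i, S (b i)) /\ v = \sum_(i < n) c i *: b i].

(* ran P', as a set of functionals; the regular module R^o serves to give
   functions into R their pointwise module structure *)
Definition dual_range (d : nat) (P : {mpoly R[d]} -> {mpoly R[d]}) :
    set ({mpoly R[d]} -> R^o) :=
  [set l | scalar l /\ kernel P `<=` kernel l].

End Functionals.

Section Projectors.
Context {R : realType} {d : nat}.
Implicit Types (P : {linear {mpoly R[d]} -> {mpoly R[d]}}) (x : 'rV[R]_d).

Definition is_ideal (I : set {mpoly R[d]}) : Prop :=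
  [/\ I 0, (forall f g, I f -> I g -> I (f + g))
         & (forall f g, I g -> I (f * g))].

Definition ideal_projector P : Prop :=
  [/\ (forall f, P (P f) = P f), is_ideal (kernel P)
    & exists s : seq {mpoly R[d]}, range P `<=` lspan [set` s]].

Definition vanishing_ideal (A : set 'rV[R]_d) : set {mpoly R[d]} :=
  [set f | forall x, A x -> meval (x 0) f = 0].

Definition lagrange_projector P : Prop :=
  ideal_projector P /\
  exists A : set 'rV[R]_d,
    [/\ finite_set A, A !=set0 & kernel P = vanishing_ideal A].

Definition delta x : {mpoly R[d]} -> R^o := fun f => meval (x 0) f.

End Projectors.

Section LexEscalier.
Context {R : realType} {d : nat}.
Implicit Types (a b m : multinom d) (f : {mpoly R[d]}) (I : set {mpoly R[d]}).

(* pure lexicographic order, first variable largest; the canonical order on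
   multinom d is graded *)
Definition lex_le a b : bool :=
  ((a : d.-tuplelexi nat) <= (b : d.-tuplelexi nat))%O.

Definition lex_leading f m : Prop :=
  m \in msupp f /\ forall m', m' \in msupp f -> lex_le m' m.

(* lem is the componentwise order on exponents, i.e. divisibility *)
Definition escalier I : set (multinom d) :=
  [set a | forall f m, I f -> f != 0 -> lex_leading f m -> ~~ lem m a].

Definition lex_range (P : {mpoly R[d]} -> {mpoly R[d]}) : set {mpoly R[d]} :=
  lspan [set mpolyX R a | a in escalier (kernel P)].

End LexEscalier.

Definition is_lower (d : nat) (D : {fset multinom d}) : Prop :=
  D != fset0 /\ forall a b, a \in D -> lem b a -> b \in D.

Section PartialDerivativeType.
Context {R : realType} {d mu : nat}.
Variables (xi : 'I_mu -> 'rV[R]_d) (D : 'I_mu -> {fset multinom d}).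
Implicit Types (P Q : {linear {mpoly R[d]} -> {mpoly R[d]}}) (h : R).

Definition mnm_row (a : multinom d) : 'rV[R]_d := \row_i (a i)%:R.

(* the norm of 'rV[R]_d provided by the library is the max norm *)
Definition l2norm (v : 'rV[R]_d) : R := Num.sqrt (\sum_i v 0 i ^+ 2).

Definition pd_projector P : Prop :=
  [/\ injective xi, (forall k, is_lower (D k)), ideal_projector P
    & dual_range P =
      lspan [set l | exists k a, a \in D k /\ l = delta (xi k) \o mderivm a]].

(* +oo when no pair qualifies *)
Definition eta0 : \bar R :=
  \big[Order.min/+oo%E]_(k < mu) \big[Order.min/+oo%E]_(l < mu | (k < l)%N)
  \big[Order.min/+oo%E]_(a <- D k) \big[Order.min/+oo%E]_(b <- D l | a != b)
    (l2norm (xi k - xi l) / l2norm (mnm_row a - mnm_row b))%:E.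

Definition perturbed_lagrange h Q : Prop :=
  [/\ 0 < `|h|, (`|h|%:E < eta0)%E, lagrange_projector Q
    & dual_range Q =
      lspan [set l | exists k a,
                       a \in D k /\ l = delta (xi k + h *: mnm_row a)]].

Definition Omega : {fset d.-tuple (R * nat)} :=
  [fset [tuple (xi k 0 i, (a : multinom d) i) | i < d]
    | k in 'I_mu, a in D k]%fset.

(* A level-k node of T(Omega) is identified with the last k coordinates of
   the elements of Omega whose paths run through it; the parent of a node is
   then its tail, and [::] is the root. *)
Definition level_nodes (k : nat) : {fset seq (R * nat)} :=
  [fset drop (d - k) (w : d.-tuple (R * nat)) | w in Omega]%fset.

(* Labels of the level-k children of the level-(k-1) node v, for 0 < k <= d;
   coordinates are counted from 0, so the (d-k+1)-th one has index d - k. *)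
Definition child_labels (k : nat) (v : seq (R * nat)) : {fset R * nat} :=
  [fset nth (0, 0%N) (w : d.-tuple (R * nat)) (d - k)
    | w in Omega & drop (d - k.-1) (w : d.-tuple (R * nat)) == v]%fset.

Definition sibling_labels (k : nat) : seq {fset R * nat} :=
  [seq child_labels k v | v <- level_nodes k.-1].

Definition label_min (L : {fset R * nat}) : \bar R :=
  \big[Order.min/+oo%E]_(x <- L)
  \big[Order.min/+oo%E]_(y <- L | (x.1 != y.1) && (x.2 != y.2))
    (`|x.1 - y.1| / `|x.2%:R - y.2%:R|)%:E.

Definition eta_init : \bar R :=
  let L1 := child_labels 1 [::] in
  if [|| #|` L1| == 1%N,
         all2rel (fun x y => x.1 == y.1) L1
       | all2rel (fun x y => x.2 == y.2) L1]
  then +oo%E else label_min L1.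

Definition eta_update (e : \bar R) (L : {fset R * nat}) : \bar R :=
  if (2 <= #|` L|)%N && (label_min L < e)%E then label_min L else e.

Definition eta : \bar R :=
  foldl (fun e k => foldl eta_update e (sibling_labels k))
        eta_init (iota 2 d.-1).

End PartialDerivativeType.

Definition converges_pointwise (R : realType) (d : nat)
    (Ph : R -> {mpoly R[d]} -> {mpoly R[d]}) (P : {mpoly R[d]} -> {mpoly R[d]}) :
    Prop :=
  forall (q : {mpoly R[d]}) (m : multinom d),
    mcoeff m (Ph h q) @[h --> 0^'] --> mcoeff m (P q).

(* Main.v *)
(* To a finite set of words over R * nat attach a "staircase" of exponents by
   recursion on the first coordinate: x1^j x^b belongs to it when b belongs to
   the staircase of the set of tails having more than j heads.  It has as many
   elements as there are words, and it depends on the words only, not on the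
   functionals attached to them.  An exponent outside the staircase is the lex
   leading exponent of a polynomial killed by all functionals: by induction some
   g with leading exponent b is killed on the tails with more than j heads, and
   x1^j g can be corrected by lower powers of x1, whose coefficients are obtained
   by interpolation, so that over every other tail it becomes a multiple of a
   monic polynomial in x1 that is killed by the heads.  This applies both to the
   functionals delta o D^a, as the words form a lower set, and to the evaluations
   at xi + h a, as soon as h separates the labels.  Hence for all small h the
   ranges of P and P_h lie in the span of the same monomials.  In this basis
   P_h q solves a square linear system whose rows are iterated difference
   quotients; these tend to the derivatives, the limit matrix is invertible, and
   Cramer's rule gives the convergence. *)
From HB Require Import structures.
Require Import Defs.
From mathcomp Require Import all_boot all_order all_algebra finmap.
From mathcomp Require Import all_classical all_reals topology normedtype.

Set Implicit Arguments.
Unset Strict Implicit.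
Unset Printing Implicit Defensive.

Import Order.TTheory GRing.Theory Num.Theory.

Local Open Scope ring_scope.
Local Open Scope classical_set_scope.

Lemma big_iota (S : Type) (idx : S) (op : S -> S -> S) n (f : nat -> S) :
  \big[op/idx]_(i <- iota 0 n) f i = \big[op/idx]_(i < n) f i.
Proof. by rewrite -(big_mkord xpredT) /index_iota subn0. Qed.

(** * The staircase of a set of words *)

Section Stair.
Context {T : eqType} (L : seq T).
Implicit Types (O : seq (seq T)) (y w : seq T) (b c : seq nat).

(** Filtering [L] rather than [O] makes every fiber duplicate-free as soon as [L] is. *)
Definition fiber O y := [seq t <- L | t :: y \in O].

Definition shadow O := undup [seq behead w | w <- O].

Definition slice j O := [seq y <- shadow O | (j < size (fiber O y))%N].

(** The bound [size O] on the first exponent is merely safe: no fiber is larger than [O], so all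
    later slices are empty and contribute nothing. *)
Fixpoint stair n O : seq (seq nat) :=
  if n is n'.+1 then
    [seq j :: b | j <- iota 0 (size O), b <- stair n' (slice j O)]
  else if O is [::] then [::] else [:: [::]].

Definition words n O := all (fun w => (size w == n) && all (mem L) w) O.

Lemma words_shadow n O : words n.+1 O -> words n (shadow O).
Proof.
move=> /allP HO; apply/allP => y; rewrite mem_undup => /mapP.
by case=> [[|t w] /HO //=] /andP[/eqP[<-] /andP[_ ?]] ->; rewrite eqxx.
Qed.

Lemma words_slice n j O : words n.+1 O -> words n (slice j O).
Proof.
move=> /words_shadow/allP HO; apply/allP => y.
by rewrite mem_filter => /andP[_ /HO].
Qed.

Lemma mem_shadow n O t y : words n.+1 O -> t :: y \in O -> y \in shadow O.
Proof. by move=> HO ty; rewrite mem_undup; apply/mapP; exists (t :: y). Qed.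

Lemma mem_fiber n O t y : words n.+1 O -> (t \in fiber O y) = (t :: y \in O).
Proof.
move=> /allP HO; rewrite mem_filter andbC; apply: andb_idl => /HO /=.
by case/andP=> _ /andP[].
Qed.

Lemma size_fiber n O y : uniq L -> words n.+1 O -> (size (fiber O y) <= size O)%N.
Proof.
move=> uL HO; rewrite -(size_map (fun t => t :: y)); apply: uniq_leq_size.
  by rewrite map_inj_uniq ?filter_uniq // => ? ? [].
by move=> w /mapP[t]; rewrite (mem_fiber _ _ HO) => ? ->.
Qed.

Lemma stair_nil n : stair n [::] = [::].
Proof. by case: n. Qed.

Lemma uniq_slice j O : uniq (slice j O).
Proof. by rewrite filter_uniq ?undup_uniq. Qed.

Lemma perm_fibers n O : uniq L -> uniq O -> words n.+1 O ->
  perm_eq O [seq t :: y | y <- shadow O, t <- fiber O y].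
Proof.
move=> uL uO HO; apply: uniq_perm => //.
  apply: allpairs_uniq_dep; first exact: undup_uniq.
    by move=> y _; rewrite filter_uniq.
  by move=> [y t] [y' t'] _ _ /= [-> ->].
move=> w; apply/idP/allpairsPdep => [wO | [y [t [_ + ->]]]].
  have := allP HO _ wO; case: w wO => // t y tyO _.
  by exists y, t; split=> //; rewrite ?(mem_fiber _ _ HO) ?(mem_shadow HO tyO).
by rewrite (mem_fiber _ _ HO).
Qed.

(** Double counting: a tail lies in exactly as many slices as it has heads, so the sizes of the
    slices and of the fibers have the same sum. *)
Lemma size_stair n O : uniq L -> uniq O -> words n O -> size (stair n O) = size O.
Proof.
move=> uL; elim: n O => [|n IHn] O uO HO /=.
  case: O uO HO => [|w [|w' O]] //=; rewrite !inE.
  case/andP=> /norP[/eqP ne _] _ /and3P[/andP[/nilP w0 _] /andP[/nilP w'0 _] _].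
  by case: ne; rewrite w0 w'0.
rewrite size_allpairs_dep.
have -> : [seq size (stair n (slice j O)) | j <- iota 0 (size O)] =
          [seq size (slice j O) | j <- iota 0 (size O)].
  by apply: eq_map => j; rewrite IHn ?uniq_slice ?words_slice.
rewrite sumnE big_map big_iota.
transitivity (\sum_(y <- shadow O) size (fiber O y))%N; last first.
  by rewrite (perm_size (perm_fibers uL uO HO)) size_allpairs_dep sumnE big_map.
transitivity (\sum_(j < size O) \sum_(y <- shadow O | (j < size (fiber O y))%N) 1)%N.
  by apply: eq_bigr => j _; rewrite size_filter sum1_count.
rewrite (exchange_big_dep predT) //= big_seq [RHS]big_seq.
apply: eq_bigr => y yO.
have le_s := size_fiber y uL HO.
by rewrite sum1_card -[RHS](card_ord (size (fiber O y))) -sum1_card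
   -(big_ord_widen _ (fun=> 1%N)) // sum1_card.
Qed.

End Stair.

(** * Reduction modulo the common kernel *)

Section LexReduction.
Context {F : fieldType} {T : eqType} (lam : T -> {poly F} -> F) (L : seq T).
Hypothesis lamE : forall t n (p : {poly F}), (size p <= n)%N ->
  lam t p = \sum_(i < n) p`_i * lam t 'X^i.
Hypothesis uL : uniq L.
Hypothesis lam_dual : forall t, t \in L ->
  exists p, forall t', t' \in L -> lam t' p = (t' == t)%:R.

(** The tensor product of the functionals [lam t], over the letters t of [w], applied to the
    monomial x^b. *)
Fixpoint mon (w : seq T) (b : seq nat) : F :=
  match w, b with
  | t :: w', j :: b' => lam t 'X^j * mon w' b'
  | _, _ => 1
  end.

(* A pair (r, b) stands for the term r x^b; only its values on words matter. *)
Definition comb (f : seq (F * seq nat)) w := \sum_(u <- f) u.1 * mon w u.2.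

Definition shift (r : F) j (f : seq (F * seq nat)) :=
  [seq (r * u.1, j :: u.2) | u <- f].

Lemma comb_cat f g w : comb (f ++ g) w = comb f w + comb g w.
Proof. exact: big_cat. Qed.

Lemma comb_shift r j f t w :
  comb (shift r j f) (t :: w) = r * lam t 'X^j * comb f w.
Proof.
by rewrite /comb big_map mulr_sumr; apply: eq_bigr => u _ /=; rewrite mulrACA.
Qed.

Lemma comb_flatten (I : Type) (s : seq I) (f : I -> seq (F * seq nat)) w :
  comb (flatten [seq f i | i <- s]) w = \sum_(i <- s) comb (f i) w.
Proof.
elim: s => [|i s IHs] /=; first by rewrite /comb !big_nil.
by rewrite comb_cat IHs big_cons.
Qed.

Definition degs n (f : seq (F * seq nat)) := all (fun u => size u.2 == n) f.

Lemma interpolation n (O : seq (seq T)) (v : seq T -> F) : words L n O ->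
  exists2 f, degs n f & {in O, forall w, comb f w = v w}.
Proof.
move=> HO.
suff [f df fv] : exists2 f, degs n f &
    forall w, size w = n -> all (mem L) w -> comb f w = v w.
  by exists f => // w /(allP HO)/andP[/eqP]; apply: fv.
elim: n v {O HO} => [|n IHn] v.
  exists [:: (v [::], [::])] => // -[] // _ _.
  by rewrite /comb big_seq1 mulr1.
have /choice[g gv] : forall t, exists f, degs n f /\ forall w, size w = n ->
    all (mem L) w -> comb f w = v (t :: w).
  by move=> t; have [f df fv] := IHn (fun w => v (t :: w)); exists f.
have /choice[p Hp] : forall t, exists p, t \in L -> forall t', t' \in L ->
    lam t' p = (t' == t)%:R.
  by move=> t; have [/lam_dual[p Hp]|] := boolP (t \in L); [exists p | exists 0].
(* The interpolant is the sum over the letters t of p_t(x1) g_t, where p_t is dual to t and g_t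
   interpolates the values on the words with head t. *)
exists (flatten [seq flatten [seq shift (p t)`_i i (g t)
                             | i <- iota 0 (size (p t))] | t <- undup L]).
  apply/allP => u /flatten_mapP[t _ /flatten_mapP[i _ /mapP[u' u'g ->]]] /=.
  by rewrite eqSS (allP (gv t).1).
case=> // t w [szw] /andP[/= tL wL]; rewrite comb_flatten.
rewrite (bigD1_seq t) ?mem_undup ?undup_uniq //= big_seq_cond big1 ?addr0.
  rewrite comb_flatten; under eq_bigr do rewrite comb_shift.
  rewrite -mulr_suml big_iota -lamE // Hp // eqxx mul1r.
  exact: (gv t).2.
move=> t'; rewrite mem_undup => /andP[t'L ne]; rewrite comb_flatten.
under eq_bigr do rewrite comb_shift.
by rewrite -mulr_suml big_iota -lamE // Hp // eq_sym (negPf ne) mul0r.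
Qed.

(* Q is lowerness for the Hermite functionals, no condition for evaluations. *)
Variable Q : seq (seq T) -> Prop.
Hypothesis Q_slice : forall n j O, words L n.+1 O -> Q O -> Q (slice L j O).
Hypothesis Q_kill : forall n O y j, words L n.+1 O -> Q O ->
  (size (fiber L O y) <= j)%N ->
  exists p : {poly F}, [/\ size p = j.+1, p`_j = 1 & {in fiber L O y, forall t, lam t p = 0}].

Lemma lex_reduction n O c : words L n O -> Q O -> size c = n -> c \notin stair L n O ->
  exists f, [/\ degs n f, all (fun u => (u.2 : seqlexi nat) < c)%O f
              & {in O, forall w, comb f w = mon w c}].
Proof.
elim: n O c => [|n IHn] O c HO QO.
  by move=> /size0nil ->; case: O HO QO => //= _ _ _; exists [::].
case: c => // j c [szc] jcO.
have [|g [dg ltg gv]] := IHn (slice L j O) c (words_slice j HO) (Q_slice j HO QO) szc.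
  have [ltj | lej] := ltnP j (size O).
    apply: contra jcO => cO; apply/allpairsPdep; exists j, c.
    by rewrite mem_iota.
  have -> : slice L j O = [::]; last by rewrite stair_nil.
  rewrite /slice (eq_filter (a2 := pred0)) ?filter_pred0 // => y /=.
  by apply: negbTE; rewrite -leqNgt (leq_trans (size_fiber y uL HO)).
(* [G] vanishes on the slice. Over any other tail y, the lower powers of x1 are chosen so that x1^j
   x^c minus the combination becomes G(y) p_y(x1), which all heads over y kill. *)
pose G y := mon y c - comb g y.
have /choice[p Hp] : forall y, exists p : {poly F},
    (size (fiber L O y) <= j)%N ->
    [/\ size p = j.+1, p`_j = 1 & {in fiber L O y, forall t, lam t p = 0}].
  move=> y; case: leqP => [/(Q_kill HO QO)[p Hp]|_]; by [exists p | exists 0].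
pose r i y := if (size (fiber L O y) <= j)%N then - G y * (p y)`_i else 0.
have /choice[q Hq] : forall i, exists f, degs n f /\
    {in shadow O, forall y, comb f y = r i y}.
  by move=> i; have [f df fv] := interpolation (r i) (words_shadow HO); exists f.
exists (shift 1 j g ++ flatten [seq shift 1 i (q i) | i <- iota 0 j]); split.
- apply/allP => u; rewrite mem_cat => /orP[/mapP[u' /(allP dg) szu ->] //|].
  move=> /flatten_mapP[i _ /mapP[u' u'q ->]] /=.
  by rewrite eqSS (allP (Hq i).1).
- apply/allP => u; rewrite mem_cat => /orP[/mapP[u' /(allP ltg) ltu ->] //=|].
    by rewrite ltxi_cons lexx.
  move=> /flatten_mapP[i + /mapP[u' u'q ->]] /=.
  rewrite mem_iota ltxi_cons leEnat => /= ltij.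
  by rewrite (ltnW ltij) leqNgt ltij.
move=> w wO; case: w wO (allP HO _ wO) => // t y tyO _.
rewrite comb_cat comb_shift comb_flatten mul1r /=.
under eq_bigr do rewrite comb_shift mul1r (Hq _).2 ?(mem_shadow HO tyO) //.
rewrite big_iota /r; case: leqP => sy; last first.
  rewrite big1 ?addr0 ?gv // => [|i _]; last by rewrite mulr0.
  by rewrite mem_filter sy (mem_shadow HO tyO).
have [szp pj p0] := Hp _ sy.
have := p0 t; rewrite (mem_fiber _ _ HO) => /(_ tyO).
rewrite (lamE _ (n := j.+1)) ?szp // big_ord_recr /= pj mul1r => /eqP.
rewrite addrC addr_eq0 => /eqP lamj.
under eq_bigr do rewrite mulrC -mulrA.
by rewrite -mulr_sumr mulNr -mulrN -lamj /G mulrBl [comb g y * _]mulrC addrC subrK mulrC.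
Qed.

End LexReduction.

(** * Nodes and Hermite functionals *)

Section NodeFunctionals.
Context {F : fieldType} {T : eqType} (x : T -> F).

Definition ev t (p : {poly F}) := p.[x t].

Lemma evE t n (p : {poly F}) : (size p <= n)%N ->
  ev t p = \sum_(i < n) p`_i * ev t 'X^i.
Proof.
by move=> sp; rewrite /ev (horner_coef_wide _ sp); under [RHS]eq_bigr do rewrite hornerXn.
Qed.

(** The witness is the Lagrange basis polynomial. *)
Lemma ev_dual (L : seq T) t : {in L &, injective x} -> t \in L ->
  exists p, forall t', t' \in L -> ev t' p = (t' == t)%:R.
Proof.
move=> injx tL; pose q := \prod_(s <- L | s != t) ('X - (x s)%:P).
have q_neq0 : q.[x t] != 0.
  rewrite horner_prod prodf_seq_neq0; apply/allP => s sL; apply/implyP => nst.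
  by rewrite hornerXsubC subr_eq0; apply: contra nst => /eqP /injx ->.
exists (q.[x t]^-1 *: q) => t' t'L; rewrite /ev hornerZ.
have [->|ne] := eqVneq t' t; first by rewrite mulVf.
suff /rootP -> : root q (x t') by rewrite mulr0.
by rewrite /q (big_rem t') //= ne rootM root_XsubC eqxx.
Qed.

(** The power of X pads the degree up to j; the additional root 0 is harmless. *)
Definition killer j (s : seq T) : {poly F} :=
  'X^(j - size s) * \prod_(t <- s) ('X - (x t)%:P).

Lemma killerP j s : (size s <= j)%N -> size (killer j s) = j.+1 /\ (killer j s)`_j = 1.
Proof.
move=> le_sj.
have mon_p : killer j s \is monic by rewrite monicMl ?monicXn ?monic_prod_XsubC.
have sz_p : size (killer j s) = j.+1.
  rewrite size_proper_mul ?size_polyXn ?size_prod_XsubC /= ?addnS ?subnK //.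
  by rewrite lead_coefXn (eqP (monic_prod_XsubC _ _ _)) mulr1 oner_eq0.
by split=> //; move/eqP: mon_p; rewrite /lead_coef sz_p.
Qed.

Lemma ev_kill j s : (size s <= j)%N ->
  exists p : {poly F}, [/\ size p = j.+1, p`_j = 1 & {in s, forall t, ev t p = 0}].
Proof.
move=> le_sj; have [szp pj] := killerP le_sj; exists (killer j s); split=> // t ts.
apply/rootP; rewrite rootM -(big_map x xpredT (fun c => 'X - c%:P)).
by rewrite root_prod_XsubC map_f ?orbT.
Qed.

End NodeFunctionals.

Section HermiteFunctionals.
Context {F : numFieldType}.
Implicit Types (t : F * nat) (p q : {poly F}).

Definition hev t p := p^`(t.2).[t.1].

Lemma hevE t n p : (size p <= n)%N ->
  hev t p = \sum_(i < n) p`_i * hev t 'X^i.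
Proof.
move=> sp; have {1}-> : p = \poly_(i < n) p`_i.
  apply/polyP => i; rewrite coef_poly; case: ltnP => // le_ni.
  by rewrite nth_default // (leq_trans sp).
rewrite /hev poly_def linear_sum horner_sum; apply: eq_bigr => i _.
by rewrite linearZ hornerZ.
Qed.

Lemma derivn_dvdp c n a p : ('X - c%:P) ^+ n %| p -> (a < n)%N -> p^`(a).[c] = 0.
Proof.
elim: a n p => [|a IHa] [|n] p //.
  move=> dv _; apply/rootP; rewrite derivn0 -dvdp_XsubCl.
  by apply: dvdp_trans dv; rewrite exprS dvdp_mulr.
move=> /dvdpP[q ->] lt_an; rewrite derivSn; apply: (IHa n) => //.
rewrite derivM deriv_exp derivXsubC mul1r /= exprS dvdp_add //.
  by rewrite mulrA dvdp_mull.
by rewrite -mulr_natl !dvdp_mull.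
Qed.

Lemma derivn_XsubC_exp c a b : ((('X - c%:P) ^+ a)^`(b)).[c] = (b == a)%:R * (a`!)%:R :> F.
Proof.
have [lt_ba|lt_ab|->] := ltngtP b a.
- by rewrite (derivn_dvdp (n := a)) // mul0r.
- by rewrite derivn_poly0 ?horner0 ?mul0r // size_exp_XsubC.
rewrite mul1r; elim: a => [|a IHa]; first by rewrite derivn0 hornerC.
rewrite derivSn deriv_exp derivXsubC mul1r derivnMn hornerMn IHa.
by rewrite factS natrM mulr_natl.
Qed.

(** Hermite interpolation by Chinese remainders: (X - c)^a / a! is dual among the labels over c, and
    the factor v g is 1 modulo (X - c)^m and 0 modulo the m-th powers at the other points, with m
    above all derivative orders in [L]. *)
Lemma hev_dual (L : seq (F * nat)) t : t \in L ->
  exists p, forall t', t' \in L -> hev t' p = (t' == t)%:R.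
Proof.
case: t => c a tL; pose m := (\max_(s <- L) s.2).+1.
have ltm s : s \in L -> (s.2 < m)%N by move=> sL; rewrite ltnS; apply: leq_bigmax_seq.
pose g := \prod_(s <- L | s.1 != c) ('X - s.1%:P) ^+ m : {poly F}.
have cop : coprimep (('X - c%:P) ^+ m) g.
  rewrite coprimep_expl // /g; elim/big_ind: _ => [|p q cp cq|s nsc].
  - exact: coprimep1.
  - by rewrite coprimepMr cp cq.
  by rewrite coprimep_expr // coprimep_XsubC2 // subr_eq0.
have /Bezout_eq1_coprimepP[[u v] /= uv1] := cop.
pose p0 := (a`!)%:R^-1 *: ('X - c%:P) ^+ a : {poly F}.
exists (p0 * (v * g)) => -[c' b] t'L; rewrite /hev /=.
have [->|ne] := eqVneq c' c; last first.
  rewrite xpair_eqE (negPf ne) (derivn_dvdp (n := m)) ?(ltm _ t'L) //.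
  by rewrite mulrA dvdp_mull // /g (big_rem (c', b)) //= ne dvdp_mulr.
have -> : p0 * (v * g) = p0 - p0 * (u * ('X - c%:P) ^+ m).
  by rewrite -[X in _ = X - _]mulr1 -uv1 mulrDr addrC addKr.
rewrite derivnB hornerD hornerN [X in _ - X](derivn_dvdp (n := m)); last 2 first.
- by rewrite mulrA dvdp_mull.
- exact: (ltm _ t'L).
rewrite subr0 derivnZ hornerZ derivn_XsubC_exp xpair_eqE eqxx /= mulrCA mulVf ?mulr1 //.
by rewrite pnatr_eq0 -lt0n fact_gt0.
Qed.

Definition label_le (s t : F * nat) := (s.1 == t.1) && (s.2 <= t.2)%N.

Definition lower_words (O : seq (seq (F * nat))) :=
  forall w w', w \in O -> all2 label_le w' w -> w' \in O.

(** By lowerness the fiber over a smaller tail contains the fiber over a larger one, so it also has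
    more than j heads. *)
Lemma lower_words_slice L n j O : words L n.+1 O -> lower_words O ->
  uniq L -> lower_words (slice L j O).
Proof.
move=> HO low uL y y'; rewrite !mem_filter => /andP[lt_j yO] le_y.
have sub : {subset fiber L O y <= fiber L O y'}.
  move=> t; rewrite !(mem_fiber _ _ HO) => /low; apply.
  by rewrite /= /label_le eqxx leqnn.
have le_s : (size (fiber L O y) <= size (fiber L O y'))%N.
  by rewrite uniq_leq_size ?filter_uniq.
rewrite (leq_trans lt_j) //=.
have : (0 < size (fiber L O y'))%N by rewrite (leq_trans _ le_s) ?(leq_ltn_trans _ lt_j).
case E: (fiber L O y') => [|t s] // _.
by apply: (mem_shadow (t := t) HO); rewrite -(mem_fiber _ _ HO) E mem_head.
Qed.

(* As the fiber is lower, a label (c, a) in it comes with a + 1 labels over c. *)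
Lemma hev_kill L n O y j : words L n.+1 O -> lower_words O ->
  (size (fiber L O y) <= j)%N ->
  exists p : {poly F},
    [/\ size p = j.+1, p`_j = 1 & {in fiber L O y, forall t, hev t p = 0}].
Proof.
move=> HO low le_sj; have [szp pj] := killerP fst le_sj.
exists (killer fst j (fiber L O y)); split=> // -[c a]; rewrite (mem_fiber _ _ HO) => caO.
apply: (derivn_dvdp (n := a.+1)) => //; rewrite dvdp_mull // (bigID (fun t => t.1 == c)) /=.
rewrite dvdp_mulr // -big_filter.
rewrite (eq_big_seq (fun=> 'X - c%:P)); last by move=> t; rewrite mem_filter => /andP[/eqP->].
rewrite big_const_seq count_predT iter_mulr mulr1 dvdp_exp2l //.
rewrite -(size_iota 0 a.+1) -(size_map (pair c)) uniq_leq_size //.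
  by rewrite map_inj_uniq ?iota_uniq // => ? ? [].
move=> t /mapP[b]; rewrite mem_iota ltnS => /= le_ba ->.
rewrite mem_filter eqxx (mem_fiber _ _ HO) /=; apply: low caO _.
rewrite /= /label_le eqxx le_ba /=.
by elim: y {le_sj szp pj} => //= s y ->; rewrite eqxx leqnn.
Qed.

End HermiteFunctionals.

(** * Difference quotients *)

Section FiniteDifferences.
Context {R : realType}.
Implicit Types (h x : R) (p : {poly R}) (t : R * nat).

Definition fdiff h p : {poly R} := h^-1 *: (p \Po ('X + h%:P) - p).

Definition fdq h t p : R := (iter t.2 (fdiff h) p).[t.1].

(** The number (-1)^(a-k) binom(a,k) h^(-a), by Pascal's recursion. *)
Fixpoint fdiff_weight h a k : R :=
  if a is a'.+1 then
    h^-1 * ((if k is k'.+1 then fdiff_weight h a' k' else 0) - fdiff_weight h a' k)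
  else (k == 0%N)%:R.

Lemma fdqE h x a p : fdq h (x, a) p =
  \sum_(k < a.+1) fdiff_weight h a k * p.[x + h * k%:R].
Proof.
(* The number of terms is left free because the induction needs n terms at x + h and n + 1 terms at
   x. *)
suff fdqE_wide n : (a < n)%N -> fdq h (x, a) p =
  \sum_(k < n) fdiff_weight h a k * p.[x + h * k%:R] by exact: fdqE_wide.
rewrite /fdq /=; elim: a n x => [|a IHa] [|n] x // lt_an.
  rewrite big_ord_recl big1 ?addr0 //= => [|i _]; last by rewrite mul0r.
  by rewrite mul1r mulr0 addr0.
rewrite iterS /fdiff hornerZ hornerD hornerN horner_comp hornerD hornerX hornerC.
rewrite (IHa n (x + h)) // (IHa n.+1 x) // ?(ltnW lt_an) //.
under [RHS]eq_bigr do rewrite /= mulrBr mulrBl -!mulrA -mulrBr.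
rewrite -mulr_sumr sumrB [in RHS]big_ord_recl /= mul0r add0r.
congr (_ * (_ - _)); apply: eq_bigr => i _.
by rewrite /bump leq0n natrD mulrDr mulr1 addrA.
Qed.

Lemma fdiff_taylor h p : h != 0 ->
  fdiff h p = \sum_(j < size p) h ^+ j *: p^`N(j.+1).
Proof.
move=> h0; rewrite /fdiff /comp_poly.
rewrite (@nderiv_taylor_wide _ (size p).+1); last 2 first.
- exact: mulrC.
- by rewrite size_map_polyC.
rewrite big_ord_recl nderivn0 expr0 mulr1 -/(comp_poly 'X p) comp_polyXr addrC addKr.
rewrite scaler_sumr; apply: eq_bigr => j _.
rewrite nderivn_map -/(comp_poly 'X _) comp_polyXr mulrC -rmorphXn mul_polyC.
by rewrite scalerA exprS mulKf.
Qed.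

Lemma iter_fdiffZ h a (c : R) p : iter a (fdiff h) (c *: p) = c *: iter a (fdiff h) p.
Proof.
elim: a => //= a ->.
by rewrite /fdiff comp_polyZ -scalerBr !scalerA mulrC.
Qed.

Lemma iter_fdiff_sum h a (I : Type) (s : seq I) (f : I -> {poly R}) :
  iter a (fdiff h) (\sum_(i <- s) f i) = \sum_(i <- s) iter a (fdiff h) (f i).
Proof.
by elim: a => //= a ->; rewrite /fdiff raddf_sum /= -sumrB scaler_sumr.
Qed.

Lemma fdqS h x a p : h != 0 ->
  fdq h (x, a.+1) p = \sum_(j < size p) h ^+ j * fdq h (x, a) p^`N(j.+1).
Proof.
move=> h0; rewrite /fdq /= -iterS iterSr fdiff_taylor // iter_fdiff_sum.
by rewrite horner_sum; apply: eq_bigr => j _; rewrite iter_fdiffZ hornerZ.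
Qed.

Lemma fdq_cvg t p : fdq h t p @[h --> 0^'] --> hev t p.
Proof.
case: t => x a; elim: a p => [|a IHa] p; first exact: cvg_cst.
(* The limit is written as the Taylor sum of [fdqS] at h = 0; only the term j = 0, the derivative of
   p, survives since 0 ^+ 0 is 1. *)
have -> : hev (x, a.+1) p = \sum_(j < size p) 0 ^+ j * hev (x, a) p^`N(j.+1).
  case E: (size p) => [|n].
    by rewrite big_ord0 /hev derivn_poly0 ?horner0 // E.
  rewrite big_ord_recl big1 ?addr0 => [|j _]; last by rewrite expr0n mul0r.
  by rewrite mul1r /hev derivSn nderivn1.
apply: cvg_trans (near_eq_cvg _) _.
  by near=> h; rewrite fdqS //; near: h; exact: nbhs_dnbhs_neq.
apply: cvg_big => [|j _]; first exact: add_continuous.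
apply: cvgM (IHa _); elim: (j : nat) => [|i IHi].
  by under eq_cvg do rewrite expr0; exact: cvg_cst.
under eq_cvg do rewrite exprS; rewrite exprS.
by apply: cvgM IHi; apply: cvg_within_filter; exact: cvg_id.
Unshelve. all: by end_near. Qed.

End FiniteDifferences.

Section MonomialWords.
Context {F : fieldType} {T : eqType}.

Lemma mon_map (lam : T -> {poly F} -> F) (I : Type) (s : seq I) (f : I -> T) (g : I -> nat) :
  mon lam [seq f i | i <- s] [seq g i | i <- s] = \prod_(i <- s) lam (f i) 'X^(g i).
Proof. by elim: s => [|i s IHs] /=; rewrite ?big_nil ?big_cons ?IHs. Qed.

End MonomialWords.

(** * Perturbed nodes and difference quotients along words *)

Section Perturbation.
Context {R : realType}.

Definition node (h : R) (t : R * nat) : R := t.1 + h * t.2%:R.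

(* Lowerness makes the words on the right nodes of P_h, so that the difference
   quotients vanish on ker P_h. *)
Lemma mon_fdq h (w : seq (R * nat)) :
  exists2 s : seq (R * seq (R * nat)),
    forall b, size b = size w ->
      mon (fdq h) w b = \sum_(u <- s) u.1 * mon (ev (node h)) u.2 b
  & forall u, u \in s -> all2 label_le u.2 w.
Proof.
elim: w => [|[x a] w [s Hs les]].
  exists [:: (1, [::])] => [[]// _|u]; first by rewrite big_seq1 mulr1.
  by rewrite inE => /eqP->.
exists [seq (fdiff_weight h a k * u.1, (x, k) :: u.2) | k <- iota 0 a.+1, u <- s].
  case=> // j b [szb]; rewrite big_allpairs_dep big_iota [LHS]/= fdqE Hs // mulr_suml.
  apply: eq_bigr => k _; rewrite mulr_sumr; apply: eq_bigr => u _.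
  exact: mulrACA.
move=> u /allpairsPdep[k [u' [+ /les leu' ->]]]; rewrite mem_iota ltnS => /= le_ka.
by rewrite /label_le eqxx le_ka.
Qed.

Lemma mon_fdq_cvg (w : seq (R * nat)) b :
  mon (fdq h) w b @[h --> 0^'] --> mon hev w b.
Proof.
elim: w b => [|t w IHw] [|j b] /=; do ?exact: cvg_cst.
by apply: cvgM (IHw b); exact: fdq_cvg.
Qed.

(** Finitely many pairs have to be separated. Labels sharing a coordinate have distinct nodes for
    every nonzero h; otherwise the difference of the nodes tends to x - x', which is nonzero. *)
Lemma near_node_inj (L : seq (R * nat)) :
  \forall h \near 0^', {in L &, injective (node h)}.
Proof.
have near_all (U : eqType) (s : seq U) (Q : U -> R -> Prop) :
    (forall u, u \in s -> \forall h \near 0^', Q u h) ->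
    \forall h \near 0^', forall u, u \in s -> Q u h.
  elim: s => [|u s IHs] Hs; first by near=> h.
  have Hu := Hs u (mem_head _ _).
  have {}IHs := IHs (fun v vs => Hs v (mem_behead (s := u :: s) vs)).
  near=> h => v; rewrite inE => /predU1P[->|]; first by near: h.
  by move: v; near: h.
have near_pair t t' : \forall h \near 0^', node h t = node h t' -> t = t'.
  case: t t' => [x a] [x' a']; rewrite /node /=.
  have [->|ne] := eqVneq a a'; first by near=> h => /addIr ->.
  have d0 : (a'%:R - a%:R : R) != 0 by rewrite subr_eq0 eqr_nat eq_sym.
  have [e0|e0] := eqVneq x x'.
    near=> h; rewrite e0 => /addrI /mulfI H; exfalso; move: ne.
    by rewrite -(eqr_nat R) H ?eqxx //; near: h; exact: nbhs_dnbhs_neq.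
  have cvg_c : (x - x') - h * (a'%:R - a%:R) @[h --> 0^'] --> (x - x') - 0 * (a'%:R - a%:R).
    apply: cvgB; first exact: cvg_cst.
    by apply: cvgM; [apply: cvg_within_filter; exact: cvg_id | exact: cvg_cst].
  near=> h => eq_node; exfalso.
  have : (x - x') - h * (a'%:R - a%:R) != 0.
    by near: h; apply: cvgr_neq0 cvg_c _; rewrite mul0r subr0 subr_eq0.
  by rewrite mulrBr opprB addrACA eq_node -opprD subrr eqxx.
have near_t t : \forall h \near 0^', forall t', t' \in L -> node h t = node h t' -> t = t'.
  by apply: near_all => t' _; exact: near_pair.
have := near_all _ L _ (fun t _ => near_t t).
by apply: filterS => h Hh t t' tL t'L; exact: Hh.
Unshelve. all: by end_near. Qed.

End Perturbation.

(** * Limits of linear systems *)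

Section CramerLimit.
Context {R : realType} {T : Type} (F : set_system T) {FF : Filter F}.

Lemma cvg_det n (A : T -> 'M[R]_n) (A0 : 'M[R]_n) :
  (forall i j, A h i j @[h --> F] --> A0 i j) -> \det (A h) @[h --> F] --> \det A0.
Proof.
move=> HA; apply: cvg_big => [|s _]; first exact: add_continuous.
apply: cvgM; first exact: cvg_cst.
by apply: cvg_big => [|i _]; [exact: mul_continuous | exact: HA].
Qed.

Lemma cvg_adj n (A : T -> 'M[R]_n) (A0 : 'M[R]_n) i j :
  (forall i j, A h i j @[h --> F] --> A0 i j) ->
  (\adj (A h)) i j @[h --> F] --> (\adj A0) i j.
Proof.
move=> HA; rewrite mxE; under eq_cvg do rewrite mxE.
apply: cvgM; first exact: cvg_cst.
apply: cvg_det => i' j'; rewrite !mxE.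
by under eq_cvg do rewrite !mxE; exact: HA.
Qed.

Lemma cvg_invmx_mul n (A : T -> 'M[R]_n) (A0 : 'M[R]_n)
    (b : T -> 'cV[R]_n) (b0 : 'cV[R]_n) i :
  A0 \in unitmx ->
  (forall i j, A h i j @[h --> F] --> A0 i j) ->
  (forall i, b h i 0 @[h --> F] --> b0 i 0) ->
  (invmx (A h) *m b h) i 0 @[h --> F] --> (invmx A0 *m b0) i 0.
Proof.
move=> uA HA Hb.
have detA := cvg_det HA.
have det0 : \det A0 != 0 by rewrite -unitfE -unitmxE.
(* [invmx] returns a singular matrix unchanged, so the adjugate formula holds for A h only once its
   determinant is nonzero, that is, eventually. *)
have invmxE (B : 'M[R]_n) (c : 'cV[R]_n) : B \in unitmx ->
    (invmx B *m c) i 0 = \sum_k (\det B)^-1 * (\adj B) i k * c k 0.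
  by move=> uB; rewrite mxE /invmx uB; apply: eq_bigr => k _; rewrite mxE.
rewrite invmxE //.
apply: cvg_trans (near_eq_cvg (f := fun h =>
    \sum_k (\det (A h))^-1 * (\adj (A h)) i k * b h k 0) _) _.
  near=> h; rewrite invmxE // unitmxE unitfE.
  by near: h; exact: cvgr_neq0 detA det0.
apply: cvg_big => [|k _]; first exact: add_continuous.
apply: cvgM (Hb k).
by apply: cvgM; [exact: cvgV | exact: cvg_adj].
Unshelve. all: by end_near. Qed.

End CramerLimit.

Definition mnm_of_seq d (s : seq nat) : multinom d :=
  Multinom [tuple nth 0%N s i | i < d].

Lemma mnm_of_seqK d (s : seq nat) : size s = d -> tval (mnm_of_seq d s) = s.
Proof.
move=> szs; apply: (@eq_from_nth _ 0%N) => [|i]; rewrite size_tuple ?szs // => ltid.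
by rewrite -[LHS](tnth_nth 0%N _ (Ordinal ltid)) tnth_mktuple.
Qed.

(** * Functionals on multivariate polynomials *)

Section WordFunctional.
Context {R : realType} {d : nat} {T : eqType}.
Variables (lam : T -> {poly R} -> R) (w : seq T).
Implicit Types f g : {mpoly R[d]}.

Definition word_eval f : R^o := \sum_(m <- msupp f) mcoeff m f * mon lam w (tval m).

Lemma word_eval_wide (s : seq (multinom d)) f : uniq s -> {subset msupp f <= s} ->
  word_eval f = \sum_(m <- s) mcoeff m f * mon lam w (tval m).
Proof.
move=> us sub; rewrite [RHS](bigID (mem (msupp f))) /= [X in _ + X]big1 => [|m]; last first.
  by move/memN_msupp_eq0 => ->; rewrite mul0r.
rewrite addr0 -big_filter; apply: perm_big; apply: uniq_perm => [||m].
- exact: msupp_uniq.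
- exact: filter_uniq.
by rewrite mem_filter /=; apply/idP/andP => [mf|[]//]; split=> //; exact: sub.
Qed.

Lemma word_eval_is_linear : linear word_eval.
Proof.
move=> c f g; pose s := undup (msupp (c *: f + g) ++ msupp f ++ msupp g).
rewrite !(word_eval_wide (undup_uniq _ : uniq s)); first last.
- by move=> m; rewrite mem_undup !mem_cat => ->.
- by move=> m; rewrite mem_undup !mem_cat => ->; rewrite orbT.
- by move=> m; rewrite mem_undup !mem_cat => ->; rewrite !orbT.
rewrite scaler_sumr -big_split; apply: eq_bigr => m _ /=.
by rewrite mcoeffD mcoeffZ mulrDl -mulrA.
Qed.

HB.instance Definition _ :=
  GRing.isLinear.Build R {mpoly R[d]} R^o _ word_eval word_eval_is_linear.

Lemma word_evalX m : word_eval (mpolyX R m) = mon lam w (tval m).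
Proof. by rewrite /word_eval msuppX big_seq1 mcoeffX eqxx mul1r. Qed.

Definition mpoly_of_comb (f : seq (R * seq nat)) : {mpoly R[d]} :=
  \sum_(u <- f) u.1 *: mpolyX R (mnm_of_seq d u.2).

Lemma word_eval_comb (f : seq (R * seq nat)) :
  degs d f -> word_eval (mpoly_of_comb f) = comb lam f w.
Proof.
move=> /allP df; rewrite linear_sum big_seq [RHS]big_seq; apply: eq_bigr => u uf.
by rewrite linearZ /= word_evalX mnm_of_seqK //; exact/eqP/df.
Qed.

End WordFunctional.

(** * Words attached to the points and lower sets *)

Section Labels.
Context {R : realType} {d : nat}.
Implicit Types (x : 'rV[R]_d) (a : multinom d).

Definition word x a : seq (R * nat) := [seq (x 0 i, a i) | i <- enum 'I_d].

Lemma mon_word (lam : R * nat -> {poly R} -> R) x a (m : multinom d) :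
  mon lam (word x a) (tval m) = \prod_(i < d) lam (x 0 i, a i) 'X^(m i).
Proof. by rewrite -[tval m]map_tnth_enum mon_map big_enum. Qed.

(** On monomials, evaluation factors over the coordinates; so does evaluation after D^a in
    [word_eval_hev]. These two identities carry the results on words over to the given dual
    ranges. *)
Lemma word_eval_node h x a (f : {mpoly R[d]}) :
  word_eval (ev (node h)) (word x a) f = delta (x + h *: mnm_row a) f.
Proof.
rewrite /delta mevalE; apply: eq_bigr => m _; rewrite mon_word; congr (_ * _).
by apply: eq_bigr => i _; rewrite /ev hornerXn !mxE.
Qed.

Lemma word_eval_hev x a (f : {mpoly R[d]}) :
  word_eval hev (word x a) f = (delta x \o mderivm a) f.
Proof.
rewrite /delta /= mderivmE raddf_sum; apply: eq_bigr => m _ /=.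
rewrite mevalZ mevalX mon_word -mulrA; congr (_ * _).
rewrite natr_prod -big_split; apply: eq_bigr => i _.
by rewrite /hev derivnXn hornerMn hornerXn /= mulr_natl mnmBE.
Qed.

Context {mu : nat} (xi : 'I_mu -> 'rV[R]_d) (D : 'I_mu -> {fset multinom d}).

Definition Omega_words : seq (seq (R * nat)) :=
  undup [seq word (xi k) a | k <- enum 'I_mu, a <- enum_fset (D k)].

(** One alphabet serves all coordinates, so a single finite set of labels has to be separated. *)
Definition Omega_labels : seq (R * nat) := undup (flatten Omega_words).

Lemma mem_Omega_words w :
  w \in Omega_words <-> exists k a, a \in D k /\ w = word (xi k) a.
Proof.
rewrite mem_undup; split=> [/allpairsPdep[k [a [_ aD ->]]]|[k [a [aD ->]]]].
  by exists k, a.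
by apply/allpairsPdep; exists k, a; rewrite mem_enum.
Qed.

Lemma words_Omega : words Omega_labels d Omega_words.
Proof.
apply/allP => w wO; apply/andP; split.
  by have [k [a [_ ->]]] := (mem_Omega_words w).1 wO; rewrite size_map size_enum_ord.
by apply/allP => t tw; rewrite /= mem_undup; apply/flattenP; exists w.
Qed.

Lemma lower_Omega : (forall k, is_lower (D k)) -> lower_words Omega_words.
Proof.
move=> lowD w w' /mem_Omega_words[k [a [aD ->]]] le_w; apply/mem_Omega_words.
have sz : size w' = d.
  by move: le_w; rewrite all2E size_map size_enum_ord => /andP[/eqP].
(* A word below that of (xi k, a) keeps the coordinates of xi k, so its exponent is read off the
   second components. *)
exists k, (mnm_of_seq d (unzip2 w')).
have le_i (i : 'I_d) : label_le (nth (0, 0%N) w' i) (xi k 0 i, a i).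
  move: le_w; rewrite all2E => /andP[_ /(all_nthP ((0, 0%N), (0, 0%N)))/(_ i)].
  rewrite size_zip sz size_map size_enum_ord minnn ltn_ord nth_zip /=; last first.
    by rewrite size_map size_enum_ord.
  by rewrite (nth_map i) ?size_enum_ord // nth_ord_enum; exact.
split.
  apply: (lowD k).2 aD _; apply/mnm_lepP => i; rewrite mnmE.
  by rewrite (nth_map (0, 0%N)) ?sz //; have /andP[] := le_i i.
apply: (@eq_from_nth _ (0, 0%N)); first by rewrite sz size_map size_enum_ord.
move=> i; rewrite sz => ltid.
rewrite (nth_map (Ordinal ltid)) ?size_enum_ord //.
have -> : nth (Ordinal ltid) (enum 'I_d) i = Ordinal ltid.
  by apply: val_inj; rewrite /= nth_enum_ord.
have /andP[/eqP /= e _] := le_i (Ordinal ltid).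
rewrite mnmE (nth_map (0, 0%N)) ?sz // -e.
by case: (nth _ _ _).
Qed.

End Labels.

(** * Projectors with lexicographic range *)

Section Projector.
Context {R : realType} {d : nat}.
Implicit Types (P : {linear {mpoly R[d]} -> {mpoly R[d]}}).

(** For the converse, each coefficient of P f is a functional of f vanishing on the kernel, hence a
    combination of elements of [S]. *)
Lemma dual_range_kernel P (S : set ({mpoly R[d]} -> R^o)) : dual_range P = lspan S ->
  forall f, P f = 0 <-> forall l, S l -> l f = 0.
Proof.
move=> eqS f; split=> [Pf0 l Sl|Sf].
  have : dual_range P l.
    rewrite eqS; exists 1%N, (fun=> 1), (fun=> l); split=> //.
    by rewrite big_ord1 scale1r.
  by case=> _; apply.
apply/mpolyP => m; rewrite mcoeff0.
have : dual_range P (fun g => mcoeff m (P g)).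
  split=> [c g k|g]; first by rewrite linearP mcoeffD mcoeffZ.
  by rewrite /kernel /= => ->; rewrite mcoeff0.
rewrite eqS => -[n [c [b [Sb /(congr1 (fun l => l f)) /= ->]]]].
rewrite fct_sumE big1 // => i _.
by rewrite -[LHS]/(c i * b i f) (Sf _ (Sb i)) mulr0.
Qed.

Variables (T : eqType) (lam : T -> {poly R} -> R) (L : seq T).
Variables (Q : seq (seq T) -> Prop) (O : seq (seq T)).
Hypothesis lamE : forall t n (p : {poly R}), (size p <= n)%N ->
  lam t p = \sum_(i < n) p`_i * lam t 'X^i.
Hypothesis uL : uniq L.
Hypothesis lam_dual : forall t, t \in L ->
  exists p, forall t', t' \in L -> lam t' p = (t' == t)%:R.
Hypothesis Q_slice : forall n j O, words L n.+1 O -> Q O -> Q (slice L j O).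
Hypothesis Q_kill : forall n O y j, words L n.+1 O -> Q O ->
  (size (fiber L O y) <= j)%N ->
  exists p : {poly R},
    [/\ size p = j.+1, p`_j = 1 & {in fiber L O y, forall t, lam t p = 0}].
Hypotheses (uO : uniq O) (HO : words L d O) (QO : Q O).

Definition stair_mnm (i : 'I_(size O)) : multinom d :=
  mnm_of_seq d (nth [::] (stair L d O) i).

Variable P : {linear {mpoly R[d]} -> {mpoly R[d]}}.
Hypothesis kerP : forall f, P f = 0 <-> {in O, forall w, word_eval lam w f = 0}.

Lemma lex_leE (a b : multinom d) : lex_le a b = ((tval a : seqlexi nat) <= tval b)%O.
Proof. by []. Qed.

(** Otherwise x^a minus its reduction to lex smaller monomials would be an element of the kernel
    with leading exponent a. *)
Lemma escalier_stair a : escalier (kernel P) a -> tval a \in stair L d O.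
Proof.
move=> Ea; apply: contrapT => /negP aO.
have [f [df ltf fv]] := lex_reduction lamE uL lam_dual Q_slice Q_kill HO QO (size_tuple _) aO.
pose g := mpolyX R a - mpoly_of_comb f.
have comb0 (m : multinom d) : mcoeff m (mpoly_of_comb f : {mpoly R[d]}) != 0 ->
    ((tval m : seqlexi nat) < tval a)%O.
  apply: contra_neqT => nlt; rewrite raddf_sum /= big_seq big1 // => u uf.
  rewrite mcoeffZ mcoeffX; case: eqP => [e|_]; last by rewrite mulr0.
  move: nlt; rewrite -e mnm_of_seqK ?(eqP (allP df _ uf)) //.
  by rewrite (allP ltf _ uf).
have ga : mcoeff a g = 1.
  rewrite mcoeffB mcoeffX eqxx; apply/eqP; rewrite subr_eq addrC -subr_eq subrr.
  by rewrite eq_sym; apply: contraT => /comb0; rewrite ltxx.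
have g_ne m : m != a -> mcoeff m g != 0 -> ((tval m : seqlexi nat) < tval a)%O.
  move=> ne; rewrite mcoeffB mcoeffX [a == m]eq_sym (negPf ne) sub0r oppr_eq0.
  exact: comb0.
have Pg : P g = 0.
  apply/kerP => w wO; rewrite linearB /= word_evalX word_eval_comb // fv ?subrr //.
have := Ea g a Pg; rewrite lepm_refl => E; apply/notF/E.
- by apply/eqP => g0; move: ga; rewrite g0 mcoeff0 => /eqP; rewrite eq_sym oner_eq0.
- split=> [|m]; first by rewrite mcoeff_msupp ga oner_neq0.
  rewrite mcoeff_msupp => gm; rewrite lex_leE.
  have [->|ne] := eqVneq m a; first exact: lexx.
  exact/ltW/g_ne.
Qed.

Lemma range_stair f : range P = lex_range P ->
  exists u : 'cV[R]_(size O), P f = \sum_i u i 0 *: mpolyX R (stair_mnm i).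
Proof.
move=> rangeP; have [n [c [b [Eb ->]]]] : lex_range P (P f) by rewrite -rangeP; exists f.
have /choice[k bk] : forall i, exists j, b i = mpolyX R (stair_mnm j).
  move=> i; have [a /escalier_stair aO <-] := Eb i.
  have ltO : (index (tval a) (stair L d O) < size O)%N.
    by rewrite -(size_stair uL uO HO) index_mem.
  exists (Ordinal ltO); rewrite /stair_mnm /= nth_index //; congr (mpolyX R _).
  by apply/val_inj/val_inj; rewrite /= mnm_of_seqK ?size_tuple.
(* The given combination may repeat a monomial, so coefficients are collected. *)
exists (\col_j \sum_(i | k i == j) c i).
rewrite (partition_big k xpredT) //=; apply: eq_bigr => j _.
by rewrite mxE scaler_suml; apply: eq_bigr => i /eqP <-; rewrite bk.
Qed.

Definition stair_mx := \matrix_(i < size O, j < size O)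
  mon lam (nth [::] O i) (tval (stair_mnm j)).

(** By idempotence f - P f lies in the kernel, so P f and f agree on all words. Projecting an
    interpolant dual to each word thus yields the columns of a right inverse, which suffices for a
    square matrix. *)
Lemma stair_mx_unit : range P = lex_range P -> (forall f, P (P f) = P f) ->
  stair_mx \in unitmx.
Proof.
move=> rangeP idP.
have /choice[B HB] : forall k : 'I_(size O), exists u : 'cV[R]_(size O),
    forall i, (stair_mx *m u) i 0 = (i == k)%:R.
  move=> k.
  have [f df fv] := interpolation lamE lam_dual (fun w => (w == nth [::] O k)%:R) HO.
  have [u Pu] := range_stair (mpoly_of_comb f) rangeP.
  exists u => i; have iO : nth [::] O i \in O by rewrite mem_nth.
  have : word_eval lam (nth [::] O i) (P (mpoly_of_comb f)) = (i == k)%:R.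
    rewrite -[i == k](nth_uniq [::] (ltn_ord i) (ltn_ord k) uO) -fv // -(word_eval_comb _ _ df).
    apply/eqP; rewrite -subr_eq0 -linearB; apply/eqP.
    by apply: (kerP _).1 => //; rewrite linearB /= idP subrr.
  move=> <-; rewrite Pu linear_sum mxE; apply: eq_bigr => j _.
  by rewrite linearZ /= word_evalX mxE mulrC.
have MB : stair_mx *m (\matrix_(i, k) B k i 0) = 1%:M.
  apply/matrixP => i k; rewrite [RHS]mxE -(HB k i) !mxE.
  by apply: eq_bigr => j _; rewrite !mxE.
by have [] := mulmx1_unit MB.
Qed.

End Projector.

(** * Positivity of the thresholds *)

Section Thresholds.
Context {R : realType}.

Lemma bigmin_gt0 (I : Type) (s : seq I) (p : pred I) (f : I -> \bar R) :
  (forall i, p i -> (0 < f i)%E) -> (0 < \big[Order.min/+oo%E]_(i <- s | p i) f i)%E.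
Proof.
by move=> f0; elim/big_ind: _ => // [|x y x0 y0]; rewrite ?ltry // lt_min x0.
Qed.

Lemma label_min_gt0 (L : {fset R * nat}) : (0 < label_min L)%E.
Proof.
apply: bigmin_gt0 => s _; apply: bigmin_gt0 => t /andP[ne1 ne2].
by rewrite lte_fin divr_gt0 // normr_gt0 subr_eq0 // eqr_nat.
Qed.

(** Every value the algorithm assigns is infinite or a positive minimum. Positivity puts all small
    nonzero h within the range where the assumptions on P_h apply. *)
Lemma eta_gt0 d mu (xi : 'I_mu -> 'rV[R]_d) D : (0 < eta xi D)%E.
Proof.
rewrite /eta; have : (0 < eta_init xi D)%E.
  by rewrite /eta_init; case: ifP => _; [rewrite ltry | exact: label_min_gt0].
elim: (iota 2 d.-1) (eta_init xi D) => //= k s IHs e e0; apply: IHs.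
elim: (sibling_labels xi D k) e e0 => //= L Ls IHL e e0; apply: IHL.
by rewrite /eta_update; case: ifP => // _; exact: label_min_gt0.
Qed.

Lemma l2norm_gt0 d (v : 'rV[R]_d) : v != 0 -> 0 < l2norm v.
Proof.
move=> v0; rewrite sqrtr_gt0 lt_def sumr_ge0 => [|i _]; last exact: sqr_ge0.
rewrite andbT psumr_eq0 => [|i _]; last exact: sqr_ge0.
apply: contra v0 => /allP v0; apply/eqP/rowP => i; rewrite mxE.
by have := v0 i (mem_index_enum i); rewrite /= sqrf_eq0 => /eqP.
Qed.

Lemma eta0_gt0 d mu (xi : 'I_mu -> 'rV[R]_d) D : injective xi -> (0 < eta0 xi D)%E.
Proof.
move=> injxi; apply: bigmin_gt0 => k _; apply: bigmin_gt0 => l ltkl.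
apply: bigmin_gt0 => a _; apply: bigmin_gt0 => b neab.
rewrite lte_fin divr_gt0 // l2norm_gt0 // subr_eq0.
  by apply: contraTneq ltkl => /injxi ->; rewrite ltnn.
apply: contra neab => /eqP eqab; apply/eqP/mnmP => i.
by move/rowP/(_ i): eqab; rewrite !mxE => /eqP; rewrite eqr_nat => /eqP.
Qed.

Lemma near_lt_ereal (e : \bar R) : (0 < e)%E -> \forall h \near (0 : R)^', (`|h|%:E < e)%E.
Proof.
case: e => [e| |//]; last by move=> _; near=> h; rewrite ltry.
rewrite lte_fin => e0; have cvg_id0 : (h : R) @[h --> 0^'] --> (0 : R).
  by apply: cvg_within_filter; exact: cvg_id.
have : \forall h \near (0 : R)^', `|h| < e by apply: (cvgr0_norm_lt _ cvg_id0).
  by apply: filterS => h; rewrite lte_fin.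
Unshelve. all: by end_near. Qed.

End Thresholds.

(** The linear system solved by the staircase coordinates of a projection g of f; it serves both for
    P with [hev] and for P_h with [fdq h]. *)
Lemma stair_coordE (R : realType) (d : nat) (T : eqType) (lam : T -> {poly R} -> R)
    (L : seq T) (O : seq (seq T)) (f g : {mpoly R[d]}) (u : 'cV[R]_(size O)) :
  {in O, forall w, word_eval lam w g = word_eval lam w f} ->
  g = \sum_i u i 0 *: mpolyX R (stair_mnm L i) ->
  @stair_mx R d T lam L O *m u = \col_i word_eval lam (nth [::] O i) f.
Proof.
move=> eq_fg defg; apply/colP => i; rewrite !mxE -eq_fg ?mem_nth // defg linear_sum.
by apply: eq_bigr => j _; rewrite linearZ /= word_evalX mxE mulrC.
Qed.

Theorem theorem6 (R : realType) (d mu : nat)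
    (xi : 'I_mu -> 'rV[R]_d) (D : 'I_mu -> {fset multinom d})
    (P : {linear {mpoly R[d]} -> {mpoly R[d]}})
    (Ph : R -> {linear {mpoly R[d]} -> {mpoly R[d]}}) :
  (0 < d)%N -> (0 < mu)%N ->
  pd_projector xi D P ->
  range P = lex_range P ->
  (forall h : R,
     0 < `|h| -> (`|h|%:E < eta xi D)%E -> (`|h|%:E < eta0 xi D)%E ->
     perturbed_lagrange xi D h (Ph h)) ->
  (forall h : R,
     0 < `|h| -> (`|h|%:E < eta xi D)%E -> (`|h|%:E < eta0 xi D)%E ->
     range (Ph h) = lex_range (Ph h)) ->
  converges_pointwise Ph P.
Proof.
move=> _ _ [injxi lowD [idP _ _] dualP] rangeP perturbed rangePh q m.
set O := Omega_words xi D; set L := Omega_labels xi D.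
have HO : words L d O := words_Omega xi D.
have uO : uniq O := undup_uniq _.
have uL : uniq L := undup_uniq _.
have lowO : lower_words O := lower_Omega (xi := xi) lowD.
pose c := @stair_mnm d _ L O.
have kerP f : P f = 0 <-> {in O, forall w, word_eval hev w f = 0}.
  rewrite (dual_range_kernel dualP); split=> [H w /mem_Omega_words[k [a [aD ->]]]|H l].
    by rewrite word_eval_hev; apply: H; exists k, a.
  by move=> [k [a [aD ->]]]; rewrite -word_eval_hev H //; apply/mem_Omega_words; exists k, a.
have slice_low n j O' HO' low' := @lower_words_slice R L n j O' HO' low' uL.
have [u0 Pq] := range_stair (@hevE R) uL (@hev_dual R L) slice_low (@hev_kill R L)
  uO HO lowO kerP q rangeP.
have uM := stair_mx_unit (@hevE R) uL (@hev_dual R L) slice_low (@hev_kill R L)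
  uO HO lowO kerP rangeP idP.
set M0 := @stair_mx _ _ _ _ _ _ in uM.
(* Difference quotients replace the node evaluations, whose rows over a common point would coincide
   in the limit. *)
pose M h : 'M[R]_(size O) := @stair_mx R d _ (fdq h) L O.
pose b h : 'cV[R]_(size O) := \col_i word_eval (fdq h) (nth [::] O i) q.
pose b0 : 'cV[R]_(size O) := \col_i word_eval hev (nth [::] O i) q.
have M0u0 : u0 = invmx M0 *m b0.
  rewrite -[u0](mulKmx uM) (stair_coordE (f := q) _ Pq) // => w wO.
  by apply/eqP; rewrite -subr_eq0 -linearB; apply/eqP/(kerP _).1; rewrite // linearB idP subrr.
have cvgM i j : M h i j @[h --> 0^'] --> M0 i j.
  by rewrite mxE; under eq_cvg do rewrite mxE; exact: mon_fdq_cvg.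
have cvgb i : b h i 0 @[h --> 0^'] --> b0 i 0.
  rewrite mxE; under eq_cvg do rewrite mxE.
  apply: cvg_big => [|a _]; first exact: add_continuous.
  by apply: cvgMl_tmp; exact: mon_fdq_cvg.
have -> : mcoeff m (P q) = \sum_i (invmx M0 *m b0) i 0 * (c i == m)%:R.
  by rewrite Pq raddf_sum -M0u0; apply: eq_bigr => i _; rewrite /= mcoeffZ mcoeffX.
apply: cvg_trans (near_eq_cvg (f := fun h =>
    \sum_i (invmx (M h) *m b h) i 0 * (c i == m)%:R) _) _; last first.
  apply: cvg_big => [|i _]; first exact: add_continuous.
  by apply: cvgMr_tmp; exact: cvg_invmx_mul.
have detM : \det M0 != 0 by rewrite -unitfE -unitmxE.
near=> h.
have h_gt0 : 0 < `|h| by rewrite normr_gt0; near: h; exact: nbhs_dnbhs_neq.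
have lt_eta : (`|h|%:E < eta xi D)%E by near: h; apply: near_lt_ereal; exact: eta_gt0.
have lt_eta0 : (`|h|%:E < eta0 xi D)%E by near: h; apply: near_lt_ereal; exact: eta0_gt0.
have inj_node : {in L &, injective (node h)} by near: h; exact: near_node_inj.
(* Invertibility comes from the limit matrix, by continuity of the determinant. *)
have uMh : M h \in unitmx.
  by rewrite unitmxE unitfE; near: h; exact: cvgr_neq0 (cvg_det cvgM) detM.
have [_ _ [[idPh _ _] _] dualPh] := perturbed h h_gt0 lt_eta lt_eta0.
have kerPh f : Ph h f = 0 <-> {in O, forall w, word_eval (ev (node h)) w f = 0}.
  rewrite (dual_range_kernel dualPh); split=> [H w /mem_Omega_words[k [a [aD ->]]]|H l].
    by rewrite word_eval_node; apply: H; exists k, a.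
  by move=> [k [a [aD ->]]]; rewrite -word_eval_node H //; apply/mem_Omega_words; exists k, a.
(* The staircase depends on the words only, so P_h q is expanded in the same monomials as P q. *)
have [u Phq] := range_stair (Q := fun=> True) (@evE R _ (node h)) uL
  (fun t => ev_dual inj_node) (fun _ _ _ _ _ => I)
  (fun n O' y j _ _ => @ev_kill R _ (node h) j (fiber L O' y)) uO HO I kerPh q
  (rangePh h h_gt0 lt_eta lt_eta0).
(* The words occurring in the expansion of a difference quotient lie below w, hence in [O], and
   their evaluations kill f. *)
have fdq_ker f : Ph h f = 0 -> {in O, forall w, word_eval (fdq h) w f = 0}.
  move=> /kerPh evf w wO; have [s Hs les] := mon_fdq h w.
  have szw : size w = d by have /andP[/eqP] := allP HO w wO.
  rewrite /word_eval; under eq_bigr do rewrite Hs ?size_tuple // mulr_sumr.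
  rewrite exchange_big big_seq big1 //= => v vs.
  under eq_bigr do rewrite mulrCA; rewrite -mulr_sumr.
  by rewrite [X in _ * X](evf v.2) ?mulr0 // (lowO _ _ wO) // les.
have -> : invmx (M h) *m b h = u.
  rewrite -[u](mulKmx uMh) (stair_coordE (f := q) _ Phq) // => w wO.
  by apply/eqP; rewrite -subr_eq0 -linearB; apply/eqP/fdq_ker; rewrite // linearB idPh subrr.
by rewrite Phq raddf_sum; apply: eq_bigr => i _; rewrite /= mcoeffZ mcoeffX.
Unshelve. all: by end_near. Qed.
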